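(* Let $A(x)$ and $B(x)$ be proper rational power series with coefficients in a field $F$. Then $A(t)B(x/t)$, as a rational function of $t$ (over the field $F(x)$), has a partial fraction expansion of the form $U(x,t)+V(x,t)$ in which, as elements of the Laurent series field $F((t))((x))$, $U(x,t)$ has only nonnegative powers of $t$ and $V(x,t)$ has only negative powers of $t$. Thus $A(x)*B(x)$ is obtained by setting $t=0$ in $U(x,t)$, that is, $A(x)*B(x)=U(x,0)$.
   Context: A proper rational power series is a formal power series equal to a quotient $P(x)/Q(x)$ of polynomials with $\deg P<\deg Q$. The Hadamard product of $\sum_{n\ge0}a_nx^n$ and $\sum_{n\ge0}b_nx^n$ is $\sum_{n\ge0}a_nx^n*\sum_{n\ge0}b_nx^n=\sum_{n\ge0}a_nb_nx^n$. A partial fraction expansion of the form $U+V$ of a rational function $f$ of $t$ over $F(x)$ means $f=U+V$ with $U=P_1/Q_1$ and $V=P_2/Q_2$, where $P_1,P_2,Q_1,Q_2$ are polynomials in $t$ over $F(x)$, $Q_1$ and $Q_2$ are relatively prime, $Q_1Q_2$ is a denominator of $f$ (not necessarily in lowest terms), and $\deg_tP_i<\deg_tQ_i$. $F((t))((x))$ is the field of Laurent series in $x$ whose coefficients are Laurent series in $t$ over $F$; rational functions in $F(x,t)$ are viewed as elements of it. An element has only nonnegative (respectively only negative) powers of $t$ if the coefficient in $F((t))$ of each power of $x$ involves only nonnegative (respectively only negative) powers of $t$. *)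

(* Defs.v *)
From HB Require Import structures.
From mathcomp Require Export all_boot all_order all_algebra.
From mathcomp Require Export boolp classical_sets fsbigop.
From mathcomp Require Import zify.

Set Implicit Arguments.
Unset Strict Implicit.
Unset Printing Implicit Defensive.

Import Order.TTheory GRing.Theory Num.Theory.
Local Open Scope classical_set_scope.
Local Open Scope ring_scope.

(* A formal Laurent series over K is its family of coefficients. *)
Definition bounded_below (K : fieldType) (f : int -> K) : Prop :=
  exists N : int, forall n, n < N -> f n = 0.

Record laurent (K : fieldType) :=
  Laurent { lcoef :> int -> K; _ : `[< bounded_below lcoef >] }.

HB.instance Definition _ (K : fieldType) := [isSub for @lcoef K].
HB.instance Definition _ (K : fieldType) := [Choice of laurent K by <:].

Lemma laurentP (K : fieldType) (f g : laurent K) :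
  (forall n, f n = g n) -> f = g.
Proof. by move=> fg; apply/val_inj/funext. Qed.

Lemma laurent_bounded (K : fieldType) (f : laurent K) : bounded_below f.
Proof. by case: f => f /= /asboolP. Qed.

Definition mkLaurent (K : fieldType) (f : int -> K) (fP : bounded_below f) :
  laurent K := Laurent (asboolT fP).

(* The series X^a * (\sum_k p_k X^k). *)
Definition shift_coef (K : fieldType) (a : int) (p : nat -> K) (n : int) : K :=
  if n - a is Posz k then p k else 0.

Lemma shift_bounded (K : fieldType) a (p : nat -> K) :
  bounded_below (shift_coef a p).
Proof.
exists a => n na; rewrite /shift_coef.
by case E: (n - a) => [k|k] //; exfalso; lia.
Qed.

Definition shift_series (K : fieldType) a (p : nat -> K) : laurent K :=
  mkLaurent (shift_bounded a p).

Lemma shift_seriesP (K : fieldType) (f : laurent K) (a : int) :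
  (forall n, n < a -> f n = 0) ->
  f = shift_series a (fun k => f (a + k%:Z)).
Proof.
move=> fa; apply: laurentP => n /=; rewrite /shift_coef.
case E: (n - a) => [k|k]; first by congr (f _); lia.
by apply: fa; lia.
Qed.

Lemma shift_series_ex (K : fieldType) (f : laurent K) :
  exists a p, f = shift_series a p.
Proof.
by have [a fa] := laurent_bounded f; do 2!eexists; exact: shift_seriesP fa.
Qed.

Lemma shift_coefE (K : fieldType) a (p : nat -> K) (k : nat) :
  shift_coef a p (a + k%:Z) = p k.
Proof. by rewrite /shift_coef addrC addKr. Qed.

Lemma shift_coef0 (K : fieldType) a (p : nat -> K) (n : int) :
  n < a -> shift_coef a p n = 0.
Proof.
by move=> na; rewrite /shift_coef; case E: (n - a) => [k|k] //; exfalso; lia.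
Qed.

Lemma ladd_bounded (K : fieldType) (f g : laurent K) :
  bounded_below (fun n => f n + g n).
Proof.
have [a fa] := laurent_bounded f; have [b gb] := laurent_bounded g.
exists (Num.min a b) => n; rewrite lt_min => /andP[na nb].
by rewrite fa ?gb ?addr0.
Qed.
Definition ladd (K : fieldType) (f g : laurent K) := mkLaurent (ladd_bounded f g).

Lemma lopp_bounded (K : fieldType) (f : laurent K) :
  bounded_below (fun n => - f n).
Proof. by have [a fa] := laurent_bounded f; exists a => n /fa ->; rewrite oppr0. Qed.
Definition lopp (K : fieldType) (f : laurent K) := mkLaurent (lopp_bounded f).

(* Only finitely many terms of the sum are nonzero. *)
Definition lmul_coef (K : fieldType) (f g : int -> K) (n : int) : K :=
  \sum_(i \in [set: int]) f i * g (n - i).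

Lemma lmul_bounded (K : fieldType) (f g : laurent K) :
  bounded_below (lmul_coef f g).
Proof.
have [a fa] := laurent_bounded f; have [b gb] := laurent_bounded g.
exists (a + b) => n nab; apply: fsbig1 => i _.
have [ia|ai] := ltP i a; first by rewrite fa ?mul0r.
by rewrite gb ?mulr0 //; lia.
Qed.
Definition lmul (K : fieldType) (f g : laurent K) := mkLaurent (lmul_bounded f g).

Definition lconst (K : fieldType) (c : K) : laurent K :=
  shift_series 0 (fun k => if k == 0%N then c else 0).

Lemma lconstE (K : fieldType) (c : K) n :
  lconst c n = if n == 0 then c else 0.
Proof. by rewrite /= /shift_coef subr0; case: n => [[|k]|k]. Qed.

Fact laddA (K : fieldType) : associative (@ladd K).
Proof. by move=> f g h; apply: laurentP => n /=; rewrite addrA. Qed.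
Fact laddC (K : fieldType) : commutative (@ladd K).
Proof. by move=> f g; apply: laurentP => n /=; rewrite addrC. Qed.
Lemma lconst0E (K : fieldType) n : lconst (0 : K) n = 0.
Proof. by rewrite lconstE if_same. Qed.
Fact ladd0 (K : fieldType) : left_id (lconst (0 : K)) (@ladd K).
Proof.
move=> f; apply: laurentP => n.
exact: etrans (congr1 (+%R^~ (f n)) (lconst0E K n)) (add0r _).
Qed.
Fact laddN (K : fieldType) : left_inverse (lconst (0 : K)) (@lopp K) (@ladd K).
Proof.
by move=> f; apply: laurentP => n; rewrite lconst0E /= addNr.
Qed.

HB.instance Definition _ (K : fieldType) :=
  GRing.isZmodule.Build (laurent K)
    (@laddA K) (@laddC K) (@ladd0 K) (@laddN K).

Definition cauchy (K : fieldType) (p q : nat -> K) (n : nat) : K :=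
  \sum_(i < n.+1) p i * q (n - i)%N.

Lemma cauchy_poly (K : fieldType) (p q : nat -> K) (m n : nat) : (n <= m)%N ->
  cauchy p q n = (\poly_(i < m.+1) p i * \poly_(i < m.+1) q i)`_n.
Proof.
move=> nm; rewrite coefM; apply: eq_bigr => i _; rewrite !coef_poly.
by rewrite !ifT //; have := ltn_ord i; lia.
Qed.

Lemma cauchyA (K : fieldType) (p q r : nat -> K) n :
  cauchy p (cauchy q r) n = cauchy (cauchy p q) r n.
Proof.
transitivity ((\poly_(i < n.+1) p i * \poly_(i < n.+1) q i
                 * \poly_(i < n.+1) r i)`_n).
  rewrite -mulrA coefM; apply: eq_bigr => i _.
  by rewrite coef_poly ltn_ord (@cauchy_poly _ q r n) // leq_subr.
rewrite coefM; apply: eq_bigr => i _.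
rewrite (@cauchy_poly _ p q n) ?coef_poly ?ifT //.
  by rewrite ltnS leq_subr.
by rewrite -ltnS.
Qed.

Lemma cauchyC (K : fieldType) (p q : nat -> K) n : cauchy p q n = cauchy q p n.
Proof. by rewrite !(@cauchy_poly _ _ _ n) // mulrC. Qed.

Lemma lmul_shift (K : fieldType) a b (p q : nat -> K) :
  lmul (shift_series a p) (shift_series b q)
  = shift_series (a + b) (cauchy p q).
Proof.
apply: laurentP => n; rewrite [LHS]/(lmul_coef _ _ _) /lmul_coef /=.
have [nab|] := ltP n (a + b).
  rewrite shift_coef0 //; apply: fsbig1 => i _.
  have [ia|ai] := ltP i a; first by rewrite shift_coef0 ?mul0r.
  by rewrite [X in _ * X]shift_coef0 ?mulr0 //; lia.
move=> abn; have [m ->] : exists m : nat, n = (a + b + m%:Z)%R.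
  by exists `|(n - (a + b))%R|%N; lia.
rewrite shift_coefE /cauchy.
rewrite (@fsbigE _ _ _ _ _ [seq a + k%:Z | k <- iota 0 m.+1]) //; last 2 first.
- by rewrite map_inj_uniq ?iota_uniq // => i j; lia.
- move=> i _ /mapP im; have [ia|ai] := ltP i a.
    by rewrite shift_coef0 ?mul0r.
  rewrite [X in _ * X]shift_coef0 ?mulr0 //.
  rewrite ltNge; apply/negP => bi; apply: im; exists `|(i - a)%R|%N; last by lia.
  by rewrite mem_iota; lia.
rewrite big_map -(big_mkord xpredT (fun i => p i * q (m - i)%N)) /index_iota subn0.
rewrite [LHS]big_seq_cond [RHS]big_seq_cond.
apply: eq_big => [i|i /andP[]]; first by rewrite in_setT.
rewrite mem_iota => im _; rewrite shift_coefE; congr (_ * _).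
by rewrite -(shift_coefE b q); congr (shift_coef _ _ _); lia.
Qed.

Lemma shift_seriesD (K : fieldType) a (p q : nat -> K) :
  shift_series a p + shift_series a q = shift_series a (fun k => p k + q k).
Proof.
apply: laurentP => n.
change (shift_coef a p n + shift_coef a q n
        = shift_coef a (fun k => p k + q k) n).
by rewrite /shift_coef; case: (n - a)%R => k //; rewrite addr0.
Qed.

Lemma eq_shift_series (K : fieldType) a (p q : nat -> K) :
  (forall k, p k = q k) -> shift_series a p = shift_series a q.
Proof. by move/funext->. Qed.

Fact lmulA (K : fieldType) : associative (@lmul K).
Proof.
move=> f g h.
have [a [p ->]] := shift_series_ex f; have [b [q ->]] := shift_series_ex g.
have [c [r ->]] := shift_series_ex h; rewrite !lmul_shift addrA.
exact/eq_shift_series/cauchyA.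
Qed.

Fact lmulC (K : fieldType) : commutative (@lmul K).
Proof.
move=> f g.
have [a [p ->]] := shift_series_ex f; have [b [q ->]] := shift_series_ex g.
rewrite !lmul_shift addrC; exact/eq_shift_series/cauchyC.
Qed.

Fact lmul1 (K : fieldType) : left_id (lconst (1 : K)) (@lmul K).
Proof.
move=> f; have [a [p ->]] := shift_series_ex f.
rewrite lmul_shift add0r; apply: eq_shift_series => k.
rewrite /cauchy big_ord_recl /= mul1r subn0 big1 ?addr0 // => i _.
by rewrite mul0r.
Qed.

Fact lmulDl (K : fieldType) : left_distributive (@lmul K) +%R.
Proof.
move=> f g h.
have [a fa] := laurent_bounded f; have [b gb] := laurent_bounded g.
have [c [r ->]] := shift_series_ex h.
rewrite (@shift_seriesP _ f (Num.min a b)); last first.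
  by move=> n; rewrite lt_min => /andP[/fa].
rewrite (@shift_seriesP _ g (Num.min a b)); last first.
  by move=> n; rewrite lt_min => /andP[_ /gb].
rewrite shift_seriesD !lmul_shift shift_seriesD; apply: eq_shift_series => k.
by rewrite /cauchy -big_split; apply: eq_bigr => i _; rewrite mulrDl.
Qed.

Fact lconst_neq0 (K : fieldType) : lconst (1 : K) != lconst 0.
Proof.
apply/eqP => /(congr1 (fun f : laurent K => f 0)).
by rewrite !lconstE eqxx; exact/eqP/oner_neq0.
Qed.

HB.instance Definition _ (K : fieldType) :=
  GRing.Zmodule_isComNzRing.Build (laurent K)
    (@lmulA K) (@lmulC K) (@lmul1 K) (@lmulDl K) (@lconst_neq0 K).

Lemma lconst0 (K : fieldType) : lconst (0 : K) = 0. Proof. by []. Qed.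

(* The inverse is picked by choice; [lmulV] shows that it is one. *)
Definition linv (K : fieldType) (f : laurent K) : laurent K :=
  xget 0 [set g : laurent K | g * f = 1].

(* First [n] coefficients of the inverse of a power series [p], [p 0 != 0]. *)
Fixpoint inv_coefs (K : fieldType) (p : nat -> K) (n : nat) : seq K :=
  if n is m.+1 then
    let s := inv_coefs p m in
    rcons s ((p 0%N)^-1 * ((m == 0)%N%:R - \sum_(i < m) s`_i * p (m - i)%N))
  else [::].

Lemma size_inv_coefs (K : fieldType) (p : nat -> K) n : size (inv_coefs p n) = n.
Proof. by elim: n => //= n IH; rewrite size_rcons IH. Qed.

Lemma nth_inv_coefs (K : fieldType) (p : nat -> K) n k : (k < n)%N ->
  (inv_coefs p n)`_k = (inv_coefs p k.+1)`_k.
Proof.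
elim: n => // n IH; rewrite ltnS leq_eqVlt => /orP[/eqP->//|kn].
by rewrite [LHS]/= nth_rcons size_inv_coefs kn IH.
Qed.

Lemma cauchy_inv (K : fieldType) (p : nat -> K) : p 0%N != 0 ->
  exists q, forall n, cauchy q p n = (n == 0%N)%:R.
Proof.
move=> p0; exists (fun k => (inv_coefs p k.+1)`_k) => n.
rewrite /cauchy big_ord_recr /= nth_rcons size_inv_coefs ltnn eqxx subnn.
rewrite mulrC mulVKf //.
rewrite (eq_bigr (fun i : 'I_n => (inv_coefs p n)`_i * p (n - i)%N)).
  by rewrite addrC subrK.
by move=> i _; rewrite (@nth_inv_coefs _ p n i).
Qed.

Lemma shift_series_neq0 (K : fieldType) (f : laurent K) : f != 0 ->
  exists a p, f = shift_series a p /\ p 0%N != 0.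
Proof.
have [a [p ->]] := shift_series_ex f => fn0.
have ex : exists k, p k != 0.
  apply: contrapT => pn; case/eqP: fn0; apply: laurentP => n.
  rewrite -lconst0 lconstE if_same /= /shift_coef; case: (n - a) => // k.
  by apply/eqP/negPn/negP => pk; apply: pn; exists k.
pose m := ex_minn ex; have pm : p m != 0 by rewrite /m; case: ex_minnP.
exists (a + m%:Z), (fun k => p (m + k)%N); rewrite addn0; split=> //.
rewrite {1}(@shift_seriesP _ (shift_series a p) (a + m%:Z)) /=.
  apply: eq_shift_series => k; rewrite -addrA -PoszD; exact: shift_coefE.
move=> n nm; have [na|an] := ltP n a; first by rewrite shift_coef0.
have [k nk] : exists k : nat, n = a + k%:Z by exists `|(n - a)%R|%N; lia.
rewrite nk shift_coefE; apply/eqP/negPn/negP => pk.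
by move: nm; rewrite /m; case: ex_minnP => j _ /(_ _ pk); lia.
Qed.

Fact lmulV (K : fieldType) (f : laurent K) : f != 0 -> linv f * f = 1.
Proof.
move=> /shift_series_neq0[a [p [-> p0]]]; have [q qp] := cauchy_inv p0.
rewrite /linv; apply: (@xgetPex _ 0 [set g | g * _ = 1]).
exists (shift_series (- a) q) => /=.
rewrite [LHS]lmul_shift addNr; apply: eq_shift_series => k.
by rewrite qp; case: k.
Qed.

Fact linv0 (K : fieldType) : linv (0 : laurent K) = 0.
Proof.
rewrite /linv; case: xgetP => // g _ /= /eqP.
by rewrite mulr0 eq_sym oner_eq0.
Qed.

HB.instance Definition _ (K : fieldType) :=
  GRing.ComNzRing_isField.Build (laurent K) (@lmulV K) (@linv0 K).

Fact lconst_zmod (K : fieldType) : zmod_morphism (@lconst K).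
Proof.
move=> c d; apply: laurentP => n.
change (lconst (c - d) n = lconst c n - lconst d n).
by rewrite !lconstE; case: (n == 0); rewrite ?subrr.
Qed.

Fact lconst_monoid (K : fieldType) : monoid_morphism (@lconst K).
Proof.
split=> // c d; rewrite [RHS]lmul_shift add0r; apply: eq_shift_series => k.
rewrite /cauchy big_ord_recl /= subn0 big1 ?addr0; last first.
  by move=> i _; rewrite mul0r.
by case: (k == 0)%N; rewrite ?mulr0.
Qed.

HB.instance Definition _ (K : fieldType) :=
  GRing.isZmodMorphism.Build K (laurent K) (@lconst K) (@lconst_zmod K).
HB.instance Definition _ (K : fieldType) :=
  GRing.isMonoidMorphism.Build K (laurent K) (@lconst K) (@lconst_monoid K).

Definition lX (K : fieldType) : laurent K :=
  shift_series 1 (fun k => (k == 0%N)%:R).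
Arguments lX {K}.

(* A formal power series is its coefficient sequence. *)
Definition ps_laurent (K : fieldType) (a : nat -> K) : laurent K :=
  shift_series 0 a.

Definition hadamard (K : fieldType) (a b : nat -> K) : nat -> K :=
  fun n => a n * b n.

Notation ratfun K := {fraction {poly K}}.
Notation "x %:F" := (FracField.tofrac x) : ring_scope.

Definition rconst (K : fieldType) (c : K) : ratfun K := (c%:P)%:F.
Definition rX (K : fieldType) : ratfun K := ('X : {poly K})%:F.
Arguments rX {K}.

(* [v] is the value of [r] at the point [z] of the extension [iota : K -> L].
   [P / Q] need not be the chosen representative of [r], so that a removable
   common zero of the representative at [z] is harmless. *)
Definition is_value (K L : fieldType) (iota : K -> L) (z : L)
    (r : ratfun K) (v : L) : Prop :=
  exists P Q : {poly K},
    [/\ r = P%:F / Q%:F, (map_poly iota Q).[z] != 0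
      & v = (map_poly iota P).[z] / (map_poly iota Q).[z]].

(* [0] if [r] has a pole at [z]. Below, [iota] is a field embedding and [z] is
   transcendental over its image, so no pole occurs and [ratfun_at iota z] is
   the field embedding of K(X) into L that extends [iota] and maps X to [z]. *)
Definition ratfun_at (K L : fieldType) (iota : K -> L) (z : L)
    (r : ratfun K) : L :=
  xget 0 [set v | is_value iota z r v].

Lemma is_value_uniq (K L : fieldType) (iota : {rmorphism K -> L}) (z : L)
    (r : ratfun K) (v w : L) :
  is_value iota z r v -> is_value iota z r w -> v = w.
Proof.
move=> [P [Q [-> Qz ->]]] [P' [Q' [/eqP E Qz' ->]]].
have nz (q : {poly K}) : (map_poly iota q).[z] != 0 -> q%:F != 0.
  by rewrite tofrac_eq0; apply: contraNneq => ->; rewrite rmorph0 horner0.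
move: E; rewrite eqr_div ?nz // -!rmorphM tofrac_eq => /eqP E.
by apply/eqP; rewrite eqr_div // -!hornerM -!rmorphM E.
Qed.

Lemma ratfun_atE (K L : fieldType) (iota : {rmorphism K -> L}) (z : L)
    (r : ratfun K) (v : L) : is_value iota z r v -> ratfun_at iota z r = v.
Proof.
move=> rv; rewrite /ratfun_at; case: xgetP => [w _ /= rw|/(_ v)/(_ rv)//].
exact: is_value_uniq rw rv.
Qed.

(* F(x) as a subfield of F((x)). *)
Definition ratfun_series (F : fieldType) : ratfun F -> laurent F :=
  ratfun_at (@lconst F) lX.

(* In [ratfun (ratfun F)], standing for F(x)(t), t is [rX] and x is
   [rconst rX]. In [laurent (laurent F)], standing for F((t))((x)), x is [lX]
   and t is [lconst lX]; the coefficient of x^n t^m in [f] is [f n m]. *)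
Definition x_series (F : fieldType) : ratfun F -> laurent (laurent F) :=
  ratfun_at (fun c : F => lconst (lconst c)) lX.

Definition xt_series (F : fieldType) :
    ratfun (ratfun F) -> laurent (laurent F) :=
  ratfun_at (@x_series F) (lconst lX).

(* A(t) and B(x/t), as elements of F(x)(t). *)
Definition in_t (F : fieldType) (A : ratfun F) : ratfun (ratfun F) :=
  ratfun_at (fun c : F => rconst (rconst c)) rX A.

Definition in_x_over_t (F : fieldType) (B : ratfun F) : ratfun (ratfun F) :=
  ratfun_at (fun c : F => rconst (rconst c)) (rconst rX / rX) B.

Definition nonneg_powers_t (F : fieldType) (f : laurent (laurent F)) : Prop :=
  forall n m : int, m < 0 -> f n m = 0.

Definition neg_powers_t (F : fieldType) (f : laurent (laurent F)) : Prop :=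
  forall n m : int, 0 <= m -> f n m = 0.

(* The power series with coefficients [a] equals the rational function [A],
   which is a quotient P/Q with deg P < deg Q; recall that [size p] is
   deg p + 1, and 0 for p = 0. *)
Definition proper_rational (F : fieldType) (a : nat -> F) (A : ratfun F) :
    Prop :=
  ratfun_series A = ps_laurent a /\
  exists P Q : {poly F}, A = P%:F / Q%:F /\ (size P < size Q)%N.

Definition partial_fractions (K : fieldType) (f U V : ratfun K) : Prop :=
  f = U + V /\
  exists P1 Q1 P2 Q2 : {poly K},
    [/\ U = P1%:F / Q1%:F, V = P2%:F / Q2%:F, coprimep Q1 Q2,
        (exists N : {poly K}, f = N%:F / (Q1 * Q2)%:F)
      & (size P1 < size Q1)%N && (size P2 < size Q2)%N].

(* Main.v *)
From mathcomp Require Import generic_quotient zify ring.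
Require Import Defs.
From HB Require Import structures.
Set Implicit Arguments.
Unset Strict Implicit.
Unset Printing Implicit Defensive.
Import Order.TTheory GRing.Theory Num.Theory.
Local Open Scope ring_scope.

(** Write A = P/Q and B = R/S in lowest terms. Since A and B are power series,
    Q(0) and S(0) are nonzero. Let s = deg S and let S~(t) = t^s S(x/t), and
    likewise R~(t) = t^s R(x/t); these are polynomials in t over F(x), S~ has
    degree exactly s because S(0) <> 0, and
      A(t) B(x/t) = P(t) R~(t) / (Q(t) S~(t))
    is a proper fraction in t. At x = 0 the polynomial S~ degenerates to
    S(0) t^s, which is prime to Q because Q(0) <> 0; so the resultant of Q and
    S~ does not vanish, Q and S~ are coprime ([coprimep_homog]), and Bezout
    gives the partial fraction expansion U + V with U = P1/Q and V = P2/S~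
    ([partial_fractions_coprime]).

    Powers of t are controlled by a predicate on F((t))((x)) that is
    compatible with products ([t_supportedM]). The inverse of Q(t) is a power
    series in t, so U has only nonnegative powers of t. The inverse of S~ is
    t^-s times g(x/t), where g = 1/S is a power series, so it is supported in
    powers of t at most -s; as deg P2 < s, V has only negative powers of t.

    Finally the constant term in t of U, as a Laurent series in x, is the
    expansion of U(x,0), because U - U(x,0) is divisible by t among the series
    with nonnegative powers of t ([t_supported_const_term]). As V has no
    constant term in t, this is also the constant term of A(t) B(x/t), in which
    the coefficient of x^n t^0 is a_n b_n ([coef0_xt_product]). *)

(** * Evaluation of rational functions at a transcendental element *)

Lemma ratfun_frac (K : fieldType) (r : ratfun K) :
  exists P Q : {poly K}, Q != 0 /\ r = P%:F / Q%:F.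
Proof.
elim/quotW: r => x; have Q0 : (frac x).2 != 0 by exact: denom_ratioP.
exists (frac x).1, (frac x).2; split=> //; move: (_.1) (_.2) Q0 (Ratio_numden x).
move=> P Q Q0 <-.
have pi_frac p : p%:F = (\pi_(ratfun K) (Ratio p 1))%qT by rewrite piE.
have -> : Q%:F^-1 = (\pi_(ratfun K) (Ratio 1 Q))%qT.
  rewrite pi_frac -[LHS]/(FracField.inv _) !piE /FracField.invf.
  by rewrite !numden_Ratio ?oner_neq0.
rewrite pi_frac -[RHS]/(FracField.mul _ _) !piE /FracField.mulf.
by rewrite !numden_Ratio ?oner_neq0 // mulr1 mul1r.
Qed.

Lemma ratfun_at_frac (K L : fieldType) (iota : {rmorphism K -> L}) (z : L)
    (P Q : {poly K}) : (map_poly iota Q).[z] != 0 ->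
  ratfun_at iota z (P%:F / Q%:F) = (map_poly iota P).[z] / (map_poly iota Q).[z].
Proof. by move=> Qz; apply: ratfun_atE; exists P, Q. Qed.

(** When no nonzero polynomial vanishes at [z], no representative of a rational
    function has a pole there; evaluation is then total and inherits from
    polynomials the compatibility with the ring operations. *)
Section Transcendental.
Variables (K L : fieldType) (iota : {rmorphism K -> L}) (z : L).
Hypothesis z_trans : forall p : {poly K}, p != 0 -> (map_poly iota p).[z] != 0.

Lemma is_value_ratfun_at r : is_value iota z r (ratfun_at iota z r).
Proof.
have [P [Q [Q0 ->]]] := ratfun_frac r.
by exists P, Q; split; rewrite ?ratfun_at_frac ?z_trans.
Qed.

Lemma ratfun_at_zmod : zmod_morphism (ratfun_at iota z).
Proof.
move=> r r'; have [P [Q [Q0 ->]]] := ratfun_frac r.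
have [P' [Q' [Q'0 ->]]] := ratfun_frac r'.
rewrite -mulNr -rmorphN addf_div ?tofrac_eq0 // -!rmorphM -rmorphD.
rewrite !ratfun_at_frac ?z_trans ?mulf_neq0 // !(rmorphD, rmorphM, rmorphN) /=.
rewrite !(hornerD, hornerM, hornerN) -mulNr addf_div ?z_trans //.
Qed.

Lemma ratfun_at_monoid : monoid_morphism (ratfun_at iota z).
Proof.
split=> [|r r'].
  rewrite -[1]divr1 -(rmorph1 (@FracField.tofrac {poly K})).
  by rewrite ratfun_at_frac rmorph1 hornerE ?divr1 ?oner_neq0.
have [P [Q [Q0 ->]]] := ratfun_frac r.
have [P' [Q' [Q'0 ->]]] := ratfun_frac r'.
rewrite mulf_div -!rmorphM !ratfun_at_frac ?z_trans ?mulf_neq0 //.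
by rewrite !rmorphM !hornerM mulf_div.
Qed.
End Transcendental.

(** * Monomials and coefficients of Laurent series *)

Definition monom (K : fieldType) (c : K) (d : int) : laurent K :=
  shift_series d (fun k => if k == 0%N then c else 0).

Lemma lconst_monom (K : fieldType) (c : K) : lconst c = monom c 0.
Proof. by []. Qed.

Lemma lX_monom (K : fieldType) : @lX K = monom 1 1.
Proof. by apply: eq_shift_series => k; case: eqP. Qed.

Lemma monomE (K : fieldType) (c : K) d n :
  monom c d n = if n == d then c else 0.
Proof. by rewrite /= /shift_coef -subr_eq0; case: (n - d) => [[|k]|k]. Qed.

Lemma monomD (K : fieldType) (c c' : K) d :
  monom (c + c') d = monom c d + monom c' d.
Proof.
apply: laurentP => n; change (monom (c + c') d n = monom c d n + monom c' d n).
by rewrite !monomE; case: eqP => // _; rewrite addr0.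
Qed.

Lemma monomM (K : fieldType) (c c' : K) d d' :
  monom c d * monom c' d' = monom (c * c') (d + d').
Proof.
rewrite [LHS]lmul_shift; apply: eq_shift_series => k.
rewrite /cauchy big_ord_recl /= subn0 big1 ?addr0 => [|i _].
  by case: eqP; rewrite ?mulr0.
by rewrite mul0r.
Qed.

Lemma monom0 (K : fieldType) d : monom 0 d = 0 :> laurent K.
Proof. by apply: laurentP => n; rewrite monomE if_same lconst0E. Qed.

Lemma monomX (K : fieldType) (c : K) d k : monom c d ^+ k = monom (c ^+ k) (d *+ k).
Proof. by elim: k => // k IH; rewrite exprS IH monomM -exprS -mulrS. Qed.

Lemma monomV (K : fieldType) (c : K) d : c != 0 -> (monom c d)^-1 = monom c^-1 (- d).
Proof.
move=> c0; have E : monom c d * monom c^-1 (- d) = 1.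
  by rewrite monomM subrr mulfV.
have m0 : monom c d != 0.
  by apply: contra_eq_neq E => ->; rewrite mul0r eq_sym oner_neq0.
by apply: (mulfI m0); rewrite E mulfV.
Qed.

Lemma coef_monomM (K : fieldType) (c : K) d (f : laurent K) n :
  (monom c d * f) n = c * f (n - d).
Proof.
have [a [p ->]] := shift_series_ex f; rewrite [X in lcoef X]lmul_shift /=.
rewrite /shift_coef (_ : n - (d + a) = n - d - a); last by lia.
case: (n - d - a) => k; last by rewrite mulr0.
by rewrite /cauchy big_ord_recl /= subn0 big1 ?addr0 // => i _; rewrite mul0r.
Qed.

(** A coefficient of a product is a finite sum of products of coefficients, so
    any additive property of all these products passes to it. *)
Lemma coef_lmul_ind (K : fieldType) (P : K -> Prop) (f g : laurent K) n :
  P 0 -> (forall x y, P x -> P y -> P (x + y)) ->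
  (forall i, P (f i * g (n - i))) -> P ((f * g) n).
Proof.
by move=> P0 PD Pfg; change (P (lmul_coef f g n)); apply: (big_ind P).
Qed.

Lemma coef_lsum (K : fieldType) I (s : seq I) (P : pred I) (G : I -> laurent K) n :
  (\sum_(i <- s | P i) G i) n = \sum_(i <- s | P i) G i n.
Proof.
apply: (big_morph (fun f : laurent K => f n)) => //; exact: lconst0E.
Qed.

(** The coefficients of a polynomial can be read off its value at the series X,
    hence X is transcendental over the constants. *)
Lemma horner_lX (K : fieldType) (p : {poly K}) :
  (map_poly (@lconst K) p).[lX] = ps_laurent (fun k => p`_k).
Proof.
apply: laurentP => n; rewrite horner_coef size_map_poly coef_lsum.
have term i : ((map_poly (@lconst K) p)`_i * lX ^+ i) n = if n == i%:Z then p`_i else 0.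
  rewrite coef_map -[_ p`_i]/(monom p`_i 0) lX_monom monomX expr1n.
  by rewrite monomM mulr1 add0r natz monomE.
under eq_bigr => i _ do rewrite term.
rewrite /= /shift_coef subr0.
case: n {term} => [k|k]; last by rewrite big1.
have [kp|pk] := ltnP k (size p).
  rewrite (bigD1 (Ordinal kp)) //= eqxx big1 ?addr0 // => i.
  by rewrite -val_eqE /= => ik; rewrite ifF //; lia.
rewrite nth_default // big1 // => i _; case: eqP => // E.
by move: pk; case: E => ->; rewrite leqNgt ltn_ord.
Qed.

Lemma coef_ps_laurent (K : fieldType) (p : nat -> K) (n : int) :
  ps_laurent p n = if n is Posz k then p k else 0.
Proof. by rewrite /= /shift_coef subr0. Qed.

(** The inverse taken in the field of Laurent series has no negative powers as
    soon as the constant term is invertible. *)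
Lemma ps_laurentV (K : fieldType) (p : nat -> K) : p 0%N != 0 ->
  exists q, (ps_laurent p)^-1 = ps_laurent q.
Proof.
move=> p0; have [q qp] := cauchy_inv p0; exists q.
have E : ps_laurent q * ps_laurent p = 1.
  by rewrite [LHS]lmul_shift; apply: eq_shift_series => k; rewrite qp; case: k.
have pn0 : ps_laurent p != 0.
  by apply: contra_eq_neq E => ->; rewrite mulr0 eq_sym oner_neq0.
by apply: (mulIf pn0); rewrite E mulVf.
Qed.

Lemma ps_laurent_eq0 (K : fieldType) (p : {poly K}) :
  p != 0 -> ps_laurent (fun k => p`_k) != 0.
Proof.
apply: contra_neq => E; apply/polyP => k.
have := congr1 (fun f : laurent K => f k%:Z) E.
by rewrite -lconst0 lconst0E coef0 /= /shift_coef subr0.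
Qed.

Lemma horner_lX_neq0 (K : fieldType) (p : {poly K}) :
  p != 0 -> (map_poly (@lconst K) p).[lX] != 0.
Proof. by rewrite horner_lX; exact: ps_laurent_eq0. Qed.

Lemma lX_neq0 (K : fieldType) : lX != 0 :> laurent K.
Proof.
by have := horner_lX_neq0 (negbT (polyX_eq0 K)); rewrite map_polyX hornerX.
Qed.

HB.instance Definition _ (F : fieldType) :=
  GRing.isZmodMorphism.Build (ratfun F) (laurent F) (@ratfun_series F)
    (ratfun_at_zmod (@horner_lX_neq0 F)).
HB.instance Definition _ (F : fieldType) :=
  GRing.isMonoidMorphism.Build (ratfun F) (laurent F) (@ratfun_series F)
    (ratfun_at_monoid (@horner_lX_neq0 F)).

(** * Substitution of x t^k for x *)

Lemma xt_subst_bounded (K : fieldType) (k : int) (f : laurent K) :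
  bounded_below (fun n => monom (f n) (k * n)).
Proof.
by have [a fa] := laurent_bounded f; exists a => n /fa ->; rewrite monom0.
Qed.

(** The ring morphism f(x) |-> f(x t^k) from F((x)) to F((t))((x)): the
    coefficient of x^n only picks up the factor t^(k n), so boundedness below in
    x is preserved whatever the sign of k. For k = 0 this is the inclusion; for
    k = -1 it sends the series of B to B(x/t). *)
Definition xt_subst (K : fieldType) (k : int) (f : laurent K) :
  laurent (laurent K) := mkLaurent (xt_subst_bounded k f).

Lemma xt_substE (K : fieldType) k (f : laurent K) n :
  xt_subst k f n = monom (f n) (k * n).
Proof. by []. Qed.

Lemma xt_subst_monom (K : fieldType) k (c : K) d :
  xt_subst k (monom c d) = monom (monom c (k * d)) d.
Proof.
apply: laurentP => n; rewrite xt_substE !monomE.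
by case: eqP => [->|_]; rewrite ?monom0.
Qed.

Lemma xt_subst_shift (K : fieldType) k a (p : nat -> K) :
  xt_subst k (shift_series a p)
  = shift_series a (fun i => monom (p i) (k * (a + i%:Z))).
Proof.
apply: laurentP => n; rewrite xt_substE.
change (monom (shift_coef a p n) (k * n)
  = shift_coef a (fun i => monom (p i) (k * (a + i%:Z))) n).
rewrite /shift_coef; case E: (n - a) => [i|i]; last exact: monom0.
by congr (monom _ (_ * _)); lia.
Qed.

Fact xt_subst_zmod (K : fieldType) k : zmod_morphism (@xt_subst K k).
Proof.
move=> f g; apply: laurentP => n.
change (monom (f n - g n) (k * n) = monom (f n) (k * n) - monom (g n) (k * n)).
by apply/eqP; rewrite eq_sym subr_eq -monomD subrK.
Qed.

Fact xt_subst_monoid (K : fieldType) k : monoid_morphism (@xt_subst K k).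
Proof.
split=> [|f g].
  by rewrite -[LHS]/(xt_subst k (monom 1 0)) xt_subst_monom mulr0.
have [a [p ->]] := shift_series_ex f; have [b [q ->]] := shift_series_ex g.
rewrite [X in xt_subst k X]lmul_shift !xt_subst_shift [RHS]lmul_shift.
apply: eq_shift_series => n; rewrite /cauchy.
rewrite (big_morph (fun c => monom c _) (fun c c' => monomD c c' _) (monom0 _ _)).
apply: eq_bigr => i _; rewrite monomM; congr monom.
rewrite -mulrDr; congr (_ * _); have := ltn_ord i; lia.
Qed.

HB.instance Definition _ (K : fieldType) k :=
  GRing.isZmodMorphism.Build (laurent K) (laurent (laurent K)) (@xt_subst K k)
    (@xt_subst_zmod K k).
HB.instance Definition _ (K : fieldType) k :=
  GRing.isMonoidMorphism.Build (laurent K) (laurent (laurent K)) (@xt_subst K k)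
    (@xt_subst_monoid K k).

(** Evaluation is natural in the target field. This is what relates the two
    expansions of F(x), in F((x)) and in F((t))((x)). *)
Lemma is_value_morph (K L M : fieldType) (iota : {rmorphism K -> L})
    (g : {rmorphism L -> M}) z r v :
  is_value iota z r v -> is_value (g \o iota) (g z) r (g v).
Proof.
move=> [P [Q [-> Qz ->]]]; exists P, Q; split=> //.
  by rewrite map_poly_comp horner_map fmorph_eq0.
by rewrite !map_poly_comp !horner_map fmorph_div.
Qed.

(** A rational function of x expands in F((t))((x)) as in F((x)), with
    coefficients constant in t; in particular this expansion is a ring
    morphism. *)
Lemma x_seriesE (F : fieldType) (r : ratfun F) :
  x_series r = xt_subst 0 (ratfun_series r).
Proof.
pose iota : {rmorphism F -> laurent (laurent F)} := @lconst (laurent F) \o @lconst F.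
apply: (@ratfun_atE _ _ iota).
have -> : iota = xt_subst 0 \o @lconst F :> (F -> _).
  by apply/funext => c; rewrite /= [RHS]xt_subst_monom mulr0.
have -> : lX = xt_subst 0 lX :> laurent (laurent F).
  by rewrite !lX_monom xt_subst_monom mul0r.
exact/is_value_morph/(is_value_ratfun_at (@horner_lX_neq0 F)).
Qed.

Fact x_series_zmod (F : fieldType) : zmod_morphism (@x_series F).
Proof. by move=> r s; rewrite !x_seriesE !rmorphB. Qed.
Fact x_series_monoid (F : fieldType) : monoid_morphism (@x_series F).
Proof. by split=> [|r s]; rewrite !x_seriesE ?rmorph1 ?rmorphM. Qed.
HB.instance Definition _ (F : fieldType) :=
  GRing.isZmodMorphism.Build (ratfun F) (laurent (laurent F)) (@x_series F)
    (@x_series_zmod F).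
HB.instance Definition _ (F : fieldType) :=
  GRing.isMonoidMorphism.Build (ratfun F) (laurent (laurent F)) (@x_series F)
    (@x_series_monoid F).

Lemma ratfun_series_poly (F : fieldType) (p : {poly F}) :
  ratfun_series p%:F = ps_laurent (fun k => p`_k).
Proof.
rewrite -[p%:F]divr1 -(rmorph1 (@FracField.tofrac {poly F})).
by rewrite [LHS]ratfun_at_frac rmorph1 hornerC ?oner_neq0 // divr1 horner_lX.
Qed.

Lemma x_series_rconst (F : fieldType) (c : F) :
  x_series (rconst c) = lconst (lconst c).
Proof.
rewrite x_seriesE ratfun_series_poly -horner_lX map_polyC hornerC.
by rewrite [LHS]xt_subst_monom mulr0.
Qed.

Lemma x_series_rX (F : fieldType) : x_series (@rX F) = lX.
Proof.
rewrite x_seriesE ratfun_series_poly -horner_lX map_polyX hornerX.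
by rewrite !lX_monom xt_subst_monom mul0r.
Qed.

Fact rconst_zmod (F : fieldType) : zmod_morphism (@rconst F).
Proof. by move=> c d; rewrite /rconst !rmorphB. Qed.
Fact rconst_monoid (F : fieldType) : monoid_morphism (@rconst F).
Proof. by split=> [|c d]; rewrite /rconst ?rmorph1 ?rmorphM. Qed.
HB.instance Definition _ (F : fieldType) :=
  GRing.isZmodMorphism.Build F (ratfun F) (@rconst F) (@rconst_zmod F).
HB.instance Definition _ (F : fieldType) :=
  GRing.isMonoidMorphism.Build F (ratfun F) (@rconst F) (@rconst_monoid F).

Lemma horner_rX (F : fieldType) (p : {poly F}) : (map_poly (@rconst F) p).[rX] = p%:F.
Proof.
elim/poly_ind: p => [|p c IH]; first by rewrite !rmorph0 horner0.
by rewrite !rmorphD !rmorphM /= map_polyX map_polyC hornerMXaddC IH.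
Qed.

(** * The polynomial t^n p(y/t) *)

(** This is t^n p(y/t) as a polynomial in t: the factor t^n clears the powers of
    t in the denominators of p(y/t) when deg p <= n. *)
Definition homog (R : comNzRingType) (n : nat) (y : R) (p : {poly R}) : {poly R} :=
  \poly_(i < n.+1) (p`_(n - i) * y ^+ (n - i)).

Lemma horner_homog (L : fieldType) n (y z : L) (p : {poly L}) :
  (size p <= n.+1)%N -> z != 0 -> (homog n y p).[z] = z ^+ n * p.[y / z].
Proof.
move=> pn z0; rewrite horner_poly (horner_coef_wide _ pn) mulr_sumr.
rewrite (reindex_inj rev_ord_inj) /=; apply: eq_bigr => i _.
have ni : (i <= n)%N by rewrite -ltnS.
rewrite subSS subKn // expr_div_n.
have -> : z ^+ n = z ^+ (n - i) * z ^+ i by rewrite -exprD subnK.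
by field; rewrite expf_neq0.
Qed.

Lemma map_homog (R S : comNzRingType) (f : {rmorphism R -> S}) n y (p : {poly R}) :
  map_poly f (homog n y p) = homog n (f y) (map_poly f p).
Proof.
apply/polyP => i; rewrite coef_map /= !(coef_poly n.+1).
by case: ifP => _; rewrite ?rmorph0 // rmorphM rmorphXn coef_map.
Qed.

Lemma size_homog (R : comNzRingType) n (y : R) (p : {poly R}) :
  p`_0 != 0 -> size (homog n y p) = n.+1.
Proof. by move=> p0; rewrite size_poly_eq // subnn mulr1. Qed.

Lemma lead_coef_homog (R : comNzRingType) n (y : R) (p : {poly R}) :
  p`_0 != 0 -> lead_coef (homog n y p) = p`_0.
Proof.
by move=> p0; rewrite lead_coefE size_homog // coef_poly ltnSn subnn mulr1.
Qed.

Lemma homog0 (R : comNzRingType) n (p : {poly R}) : homog n 0 p = p`_0 *: 'X^n.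
Proof.
apply/polyP => i; rewrite coef_poly coefZ coefXn ltnS.
have [->|ni] := eqVneq i n; first by rewrite leqnn subnn.
case: ifP => [le_in|_]; last by rewrite mulr0.
by rewrite expr0n subn_eq0 leqNgt ltn_neqAle ni le_in !mulr0.
Qed.

(** The resultant of Q(t) and t^n S(x/t) is a polynomial in x. At x = 0 the
    second argument becomes S(0) t^n, which is coprime to Q since 0 is not a
    root of Q; the leading coefficients in t do not depend on x, so the
    resultant commutes with this specialization and is therefore nonzero. *)
Lemma coprimep_homog (F : fieldType) n (Q S : {poly F}) :
  Q`_0 != 0 -> S`_0 != 0 ->
  coprimep (map_poly (@rconst F) Q) (homog n rX (map_poly (@rconst F) S)).
Proof.
move=> Q0 S0; pose Qx := map_poly polyC Q; pose Sx := homog n 'X (map_poly polyC S).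
have Qn0 : Q != 0 by apply: contraNneq Q0 => ->; rewrite coef0.
have Sx0 : (map_poly polyC S)`_0 != 0 by rewrite coef_map polyC_eq0.
have lQ : lead_coef Qx = (lead_coef Q)%:P.
  by rewrite lead_coef_map_eq // polyC_eq0 lead_coef_eq0.
have lS : lead_coef Sx = (S`_0)%:P by rewrite lead_coef_homog // coef_map.
(* Both polynomials come from F[x][t], where x can be set to 0. *)
have -> : map_poly (@rconst F) Q = map_poly (@FracField.tofrac _) Qx.
  by rewrite -map_poly_comp.
have -> : homog n rX (map_poly (@rconst F) S) = map_poly (@FracField.tofrac _) Sx.
  by rewrite map_homog -map_poly_comp.
pose ev0 : {rmorphism {poly F} -> F} := horner_eval 0.
have ev0C c : ev0 c%:P = c by rewrite /= /horner_eval hornerC.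
have res0 : resultant Qx Sx != 0.
  apply/eqP => /(congr1 ev0); rewrite rmorph0 map_resultant; last 2 first.
  - by rewrite lQ ev0C lead_coef_eq0.
  - by rewrite lS ev0C.
  rewrite map_homog -!map_poly_comp !(eq_map_poly (g := id) ev0C) !map_poly_id //.
  rewrite [X in homog _ X]hornerX homog0 => /eqP.
  rewrite resultant_eq0 => gt1.
  have : coprimep Q (S`_0 *: 'X^n).
    by rewrite coprimepZr // coprimep_expr // coprimepX rootE horner_coef0.
  by rewrite /coprimep => /eqP E1; move: gt1; rewrite E1.
have : resultant (map_poly (@FracField.tofrac _) Qx)
                 (map_poly (@FracField.tofrac _) Sx) != 0.
  by rewrite -map_resultant ?tofrac_eq0 ?lQ ?lS ?polyC_eq0 ?lead_coef_eq0.
rewrite resultant_eq0 -leqNgt => le1; rewrite coprimep_def eqn_leq le1 lt0n.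
rewrite size_poly_eq0 gcdp_eq0 map_poly_eq0_id0 ?map_polyC_eq0 ?(negPf Qn0) //.
by rewrite lQ tofrac_eq0 polyC_eq0 lead_coef_eq0.
Qed.

(** * Partial fractions and reduced forms *)

Lemma divf_mull (K : fieldType) (u v z : K) :
  z != 0 -> (z * u) / (z * v) = u / v.
Proof. by move=> z0; rewrite -mulf_div divff // mul1r. Qed.

Lemma subr_frac (K : fieldType) (a b c d e z : K) : b != 0 -> d != 0 ->
  a * d - c * b = e * z -> a / b - c / d = z * (e * (b^-1 * d^-1)).
Proof.
move=> b0 d0 E; rewrite mulrA [z * e]mulrC -E.
by field; rewrite d0.
Qed.

Lemma mulf_partial (K : fieldType) (p1 p2 q1 q2 x y : K) : q1 != 0 -> q2 != 0 ->
  p1 * q2 + p2 * q1 = (x * q1) * (y * q2) -> x * y = p1 / q1 + p2 / q2.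
Proof.
by move=> q10 q20 E; rewrite addf_div // E mulrACA mulfK // mulf_neq0.
Qed.

Lemma mulf_frac (K : fieldType) (P Q R S : {poly K}) :
  P%:F / Q%:F * (R%:F / S%:F) = (P * R)%:F / (Q * S)%:F.
Proof. by rewrite mulf_div -!rmorphM. Qed.

Lemma size_mul_ltn (K : fieldType) (P Q R S : {poly K}) :
  (size P < size Q)%N -> (size R <= size S)%N -> S != 0 ->
  (size (P * R)%R < size (Q * S)%R)%N.
Proof.
move=> sPQ sRS S0; have Q0 : Q != 0 by rewrite -size_poly_gt0 (leq_trans _ sPQ).
have [->|P0] := eqVneq P 0; first by rewrite mul0r size_poly0 size_poly_gt0 mulf_neq0.
have [->|R0] := eqVneq R 0; first by rewrite mulr0 size_poly0 size_poly_gt0 mulf_neq0.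
rewrite !size_mul //; move: R0 sPQ sRS; rewrite -size_poly_gt0.
by move: (size P) (size Q) (size R) (size S) => p q r z; lia.
Qed.

(** From a Bezout relation u Q1 + v Q2 = 1, the numerator over Q1 is the
    remainder of N v modulo Q1; the degree of the other one is then forced by
    that of N. *)
Lemma partial_fractions_poly (K : fieldType) (N Q1 Q2 : {poly K}) :
  coprimep Q1 Q2 -> (size N < size (Q1 * Q2)%R)%N ->
  exists P1 P2 : {poly K}, [/\ N = P1 * Q2 + P2 * Q1,
    (size P1 < size Q1)%N & (size P2 < size Q2)%N].
Proof.
move=> /Bezout_eq1_coprimepP[[u v] /= uv] sN.
have [Q10 Q20] : Q1 != 0 /\ Q2 != 0.
  by apply/andP; rewrite -negb_or -mulf_eq0 -size_poly_eq0 -lt0n (leq_trans _ sN).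
pose P1 : {poly K} := (N * v) %% Q1; pose P2 : {poly K} := N * u + (N * v) %/ Q1 * Q2.
have sP1 : (size P1 < size Q1)%N by rewrite ltn_modp.
have E : N = P1 * Q2 + P2 * Q1.
  have -> : N = N * v * Q2 + N * u * Q1 by rewrite -{1}[N]mulr1 -uv; ring.
  by rewrite {1}(divp_eq (N * v) Q1) -/P1 /P2; ring.
exists P1, P2; split=> //.
have [->|P20] := eqVneq P2 0; first by rewrite size_poly0 lt0n size_poly_eq0.
have : (size (P2 * Q1)%R < size (Q1 * Q2)%R)%N.
  have -> : P2 * Q1 = N - P1 * Q2 by rewrite {1}E; ring.
  rewrite (leq_ltn_trans (size_polyD _ _)) // gtn_max sN size_polyN /=.
  have [->|P10] := eqVneq P1 0; first by rewrite mul0r size_poly0 (leq_trans _ sN).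
  rewrite !size_mul //; move: sP1; rewrite -[size Q2]prednK ?lt0n ?size_poly_eq0 //.
  by rewrite !addnS /= ltn_add2r.
rewrite mulrC !size_mul // -[size Q1]prednK ?lt0n ?size_poly_eq0 //.
by rewrite !addSn /= ltn_add2l.
Qed.

Lemma partial_fractions_coprime (K : fieldType) (N Q1 Q2 : {poly K}) :
  coprimep Q1 Q2 -> (size N < size (Q1 * Q2)%R)%N ->
  exists P1 P2 : {poly K}, [/\ N = P1 * Q2 + P2 * Q1, (size P2 < size Q2)%N
    & partial_fractions (N%:F / (Q1 * Q2)%:F) (P1%:F / Q1%:F) (P2%:F / Q2%:F)].
Proof.
move=> co sN; have [P1 [P2 [NE sP1 sP2]]] := partial_fractions_poly co sN.
have [Q10 Q20] : Q1 != 0 /\ Q2 != 0.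
  by apply/andP; rewrite -negb_or -mulf_eq0 -size_poly_eq0 -lt0n (leq_trans _ sN).
exists P1, P2; split=> //; split.
  by rewrite NE rmorphD !rmorphM addf_div ?tofrac_eq0.
by exists P1, Q1, P2, Q2; split=> //; [exists N | rewrite sP1].
Qed.

(** In lowest terms P/Q, if Q(0) were 0 then so would be P(0), the constant
    term of the power series a times Q, and X would divide both. *)
Lemma proper_rational_reduced (F : fieldType) (a : nat -> F) (A : ratfun F) :
  proper_rational a A ->
  exists P Q : {poly F}, [/\ A = P%:F / Q%:F, (size P < size Q)%N, Q`_0 != 0
    & ps_laurent a * ratfun_series Q%:F = ratfun_series P%:F].
Proof.
move=> [aA [P0 [Q0 [eA sPQ]]]]; subst A.
have Q00 : Q0 != 0 by rewrite -size_poly_gt0 (leq_trans _ sPQ).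
pose g := gcdp P0 Q0; have g0 : g != 0 by rewrite gcdp_eq0 negb_and Q00 orbT.
have co : coprimep (P0 %/ g) (Q0 %/ g) by rewrite coprimep_div_gcd ?Q00 ?orbT.
have eP : P0 = P0 %/ g * g by rewrite divpK ?dvdp_gcdl.
have eQ : Q0 = Q0 %/ g * g by rewrite divpK ?dvdp_gcdr.
move: (P0 %/ g) (Q0 %/ g) co eP eQ => P Q co eP eQ; exists P, Q.
have Qn0 : Q != 0 by apply: contraNneq Q00 => Q_0; rewrite eQ Q_0 mul0r.
have E : P0%:F / Q0%:F = P%:F / Q%:F.
  rewrite eP eQ !rmorphM -mulf_div divff ?mulr1 // tofrac_eq0 //.
have sPQ' : (size P < size Q)%N.
  have [->|Pn0] := eqVneq P 0; first by rewrite size_poly0 size_poly_gt0.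
  move: sPQ; rewrite eP eQ !size_mul //.
  by rewrite -[size g]prednK ?lt0n ?size_poly_eq0 // !addnS /= ltn_add2r.
have aQP : ps_laurent a * ratfun_series Q%:F = ratfun_series P%:F.
  by rewrite -aA E -rmorphM divfK // tofrac_eq0.
split=> //; apply/negP => /eqP Q_0.
have P_0 : P`_0 = 0.
  have <- : ratfun_series P%:F 0 = P`_0 by rewrite ratfun_series_poly.
  rewrite -aQP ratfun_series_poly.
  have -> : ps_laurent a * ps_laurent (fun k => Q`_k) =
    shift_series (0 + 0) (cauchy a (fun k => Q`_k)) := lmul_shift _ _ _ _.
  change (cauchy a (fun k => Q`_k) 0 = 0).
  by rewrite /cauchy big_ord1 subn0 Q_0 mulr0.
have := coprimep_root co (x := 0).
by rewrite rootE !horner_coef0 P_0 Q_0 eqxx => /(_ isT).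
Qed.

(** * Powers of t occurring in an element of F((t))((x)) *)

Definition t_supported (F : fieldType) (D : pred int) (f : laurent (laurent F)) :=
  forall n m, ~~ D m -> f n m = 0.

Lemma t_supportedM (F : fieldType) (D1 D2 D3 : pred int) (f g : laurent (laurent F)) :
  (forall i j, D1 i -> D2 j -> D3 (i + j)) ->
  t_supported D1 f -> t_supported D2 g -> t_supported D3 (f * g).
Proof.
move=> D12 fD gD n m nD.
apply: (@coef_lmul_ind (laurent F) (fun c => c m = 0)).
- exact: lconst0E.
- move=> x y x0 y0; change (x m + y m = 0).
  by rewrite x0 y0 addr0.
move=> i; apply: fsbig1 => j _; case Dj: (D1 j); last by rewrite fD ?Dj ?mul0r.
rewrite gD ?mulr0 //; apply: contraNN nD => Dm.
by rewrite -(subrK j m) addrC; exact: D12.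
Qed.

Lemma t_supported_sum (F : fieldType) (D : pred int) k
    (G : 'I_k -> laurent (laurent F)) :
  (forall i, t_supported D (G i)) -> t_supported D (\sum_i G i).
Proof.
by move=> GD n m nD; rewrite !coef_lsum big1 // => i _; exact: GD.
Qed.

Lemma t_supported_lconst (F : fieldType) (D : pred int) (g : laurent F) :
  (forall m, ~~ D m -> g m = 0) -> t_supported D (lconst g).
Proof.
by move=> gD n m nD; rewrite lconstE; case: (n == 0); rewrite ?gD // -lconst0 lconst0E.
Qed.

Lemma t_supported_monom (F : fieldType) (c : F) d :
  t_supported (pred1 d) (lconst (monom c d)).
Proof.
apply: t_supported_lconst => m md; have {}md : m != d := md.
by rewrite monomE (negPf md).
Qed.

Lemma t_supported_x_series (F : fieldType) (r : ratfun F) :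
  t_supported (pred1 0) (x_series r).
Proof.
move=> n m m0; have {}m0 : m != 0 := m0.
by rewrite x_seriesE xt_substE monomE mul0r (negPf m0).
Qed.

(** The expansion in F((t))((x)) of a polynomial in t over F(x). *)
Definition xt_poly (F : fieldType) (p : {poly ratfun F}) : laurent (laurent F) :=
  (map_poly (@x_series F) p).[lconst lX].

Fact xt_poly_zmod (F : fieldType) : zmod_morphism (@xt_poly F).
Proof. by move=> p q; rewrite /xt_poly rmorphB hornerD hornerN. Qed.
Fact xt_poly_monoid (F : fieldType) : monoid_morphism (@xt_poly F).
Proof. by split=> [|p q]; rewrite /xt_poly ?rmorph1 ?hornerC ?rmorphM ?hornerM. Qed.
HB.instance Definition _ (F : fieldType) :=
  GRing.isZmodMorphism.Build {poly ratfun F} (laurent (laurent F)) (@xt_poly F)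
    (@xt_poly_zmod F).
HB.instance Definition _ (F : fieldType) :=
  GRing.isMonoidMorphism.Build {poly ratfun F} (laurent (laurent F)) (@xt_poly F)
    (@xt_poly_monoid F).

Lemma xt_polyC (F : fieldType) (r : ratfun F) : xt_poly r%:P = x_series r.
Proof. by rewrite /xt_poly map_polyC hornerC. Qed.

Lemma xt_polyX (F : fieldType) : xt_poly 'X = lconst lX :> laurent (laurent F).
Proof. by rewrite /xt_poly map_polyX hornerX. Qed.

(** The coefficients of p involve no t, so the powers of t come from those of
    the variable alone. *)
Lemma t_supported_xt_poly (F : fieldType) (p : {poly ratfun F}) :
  t_supported (fun m => (0 <= m) && (m < (size p)%:Z)) (xt_poly p).
Proof.
rewrite /xt_poly horner_coef size_map_poly; apply: t_supported_sum => i.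
rewrite coef_map /= -rmorphXn lX_monom monomX expr1n natz.
apply: (t_supportedM (D1 := pred1 0) (D2 := pred1 (i : nat)%:Z)).
- by move=> j k /eqP-> /eqP->; rewrite add0r ltz_nat ltn_ord.
- exact: t_supported_x_series.
exact: t_supported_monom.
Qed.

Lemma xt_series_frac (F : fieldType) (P Q : {poly ratfun F}) : xt_poly Q != 0 ->
  xt_series (P%:F / Q%:F) = xt_poly P / xt_poly Q.
Proof. exact: ratfun_at_frac. Qed.

(** * Expansions of the two denominators *)

(** For a polynomial in t alone, the expansion is constant in x: it is the
    expansion in one variable, read in t. *)
Lemma xt_poly_rconst (F : fieldType) (p : {poly F}) :
  xt_poly (map_poly (@rconst F) p) = lconst (ratfun_series p%:F).
Proof.
rewrite ratfun_series_poly -horner_lX -horner_map -!map_poly_comp /xt_poly.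
congr (_.[_]); rewrite -map_poly_comp; apply: eq_map_poly => c.
exact: x_series_rconst.
Qed.

(** The expansion of t^n p(x/t) is t^n times that of p, with x/t substituted for
    x. In particular, inverting it amounts to inverting a series in one
    variable. *)
Lemma xt_poly_homog (F : fieldType) n (p : {poly F}) : (size p <= n.+1)%N ->
  xt_poly (homog n rX (map_poly (@rconst F) p))
  = lconst lX ^+ n * xt_subst (-1) (ratfun_series p%:F).
Proof.
move=> pn; have X0 := lX_neq0 F.
rewrite /xt_poly map_homog [_ rX]x_series_rX -map_poly_comp.
rewrite horner_homog ?fmorph_eq0 ?size_map_poly //; congr (_ * _).
rewrite ratfun_series_poly -horner_lX -horner_map -map_poly_comp; congr (_.[_]).
  apply: eq_map_poly => c; rewrite /= x_series_rconst.
  by rewrite [RHS]xt_subst_monom mulr0.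
have xt_lX : xt_subst (-1) lX = monom (monom 1 (-1)) 1 :> laurent (laurent F).
  by rewrite lX_monom xt_subst_monom.
rewrite [RHS]xt_lX lX_monom lconst_monom monomV ?lX_neq0 //.
by rewrite lX_monom monomV ?oner_neq0 // invr1 monomM mul1r subr0.
Qed.

(** * Constant terms in t *)

(** With Q(0) and P(0) the values at t = 0, P Q(0) - P(0) Q vanishes at t = 0,
    hence is t times a polynomial; dividing by Q Q(0), which introduces no
    negative power of t, shows that P/Q - P(0)/Q(0) has only positive powers
    of t. *)
Lemma t_supported_const_term (F : fieldType) (P Q : {poly ratfun F}) :
  Q.[0] != 0 -> xt_poly Q != 0 -> t_supported (fun m => 0 <= m) (xt_poly Q)^-1 ->
  t_supported (fun m => 0 < m) (xt_poly P / xt_poly Q - x_series (P.[0] / Q.[0])).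
Proof.
move=> Q0 EQ0 Qinv.
have /factor_theorem[N NE] : root (P * Q.[0]%:P - P.[0]%:P * Q) 0.
  by rewrite rootE !hornerE mulrC subrr.
have x0 : x_series Q.[0] != 0 by rewrite fmorph_eq0.
have {}NE : xt_poly P * x_series Q.[0] - x_series P.[0] * xt_poly Q
    = xt_poly N * lconst lX.
  by rewrite -!xt_polyC -xt_polyX -!rmorphM -rmorphB NE subr0.
rewrite fmorph_div (subr_frac EQ0 x0 NE) -fmorphV.
apply: (t_supportedM (D1 := pred1 1) (D2 := fun m => 0 <= m)).
- by move=> i j /eqP->; lia.
- by rewrite lX_monom; exact: t_supported_monom.
have D1 (i j : int) : (0 <= i) && (i < (size N)%:Z) -> 0 <= j -> 0 <= i + j.
  by move=> /andP[i0 _]; exact: addr_ge0.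
have D2 (i j : int) : 0 <= i -> pred1 0 j -> 0 <= i + j.
  by move=> i0 /eqP->; rewrite addr0.
apply: (t_supportedM D1 (@t_supported_xt_poly _ N)).
exact: (t_supportedM D2 Qinv (@t_supported_x_series _ _)).
Qed.

(** * The product A(t) B(x/t) *)

Lemma in_tE (F : fieldType) (P Q : {poly F}) : Q != 0 ->
  in_t (P%:F / Q%:F) = (map_poly (@rconst F) P)%:F / (map_poly (@rconst F) Q)%:F.
Proof.
move=> Q0.
pose iota : {rmorphism F -> ratfun (ratfun F)} := @rconst (ratfun F) \o @rconst F.
have E (p : {poly F}) : (map_poly iota p).[rX] = (map_poly (@rconst F) p)%:F.
  by rewrite map_poly_comp; exact: horner_rX.
have Q1 : (map_poly iota Q).[rX] != 0 by rewrite E tofrac_eq0 map_poly_eq0.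
rewrite -(E P) -(E Q); exact (ratfun_at_frac P Q1).
Qed.

Lemma in_x_over_tE (F : fieldType) n (P Q : {poly F}) :
  (size P <= n.+1)%N -> (size Q <= n.+1)%N -> Q`_0 != 0 ->
  in_x_over_t (P%:F / Q%:F)
  = (homog n rX (map_poly (@rconst F) P))%:F / (homog n rX (map_poly (@rconst F) Q))%:F.
Proof.
move=> sP sQ Q0.
pose iota : {rmorphism F -> ratfun (ratfun F)} := @rconst (ratfun F) \o @rconst F.
have X0 : rX != 0 :> ratfun (ratfun F) by rewrite tofrac_eq0 polyX_eq0.
have E (p : {poly F}) : (size p <= n.+1)%N ->
    (homog n rX (map_poly (@rconst F) p))%:F
    = rX ^+ n * (map_poly iota p).[rconst rX / rX].
  move=> sp; have -> : map_poly iota p = map_poly (@rconst _) (map_poly (@rconst F) p).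
    exact: map_poly_comp.
  rewrite -horner_rX map_homog.
  by apply: horner_homog X0; rewrite !size_map_poly.
have Q1 : (map_poly iota Q).[rconst rX / rX] != 0.
  have : homog n rX (map_poly (@rconst F) Q) != 0.
    by rewrite -size_poly_gt0 size_homog // coef_map fmorph_eq0.
  by rewrite -tofrac_eq0 (E Q sQ) mulf_eq0 negb_or => /andP[].
rewrite (E P sP) (E Q sQ).
exact (etrans (ratfun_at_frac P Q1) (esym (divf_mull _ _ (expf_neq0 n X0)))).
Qed.

(** The product is the sum of a_i b_n t^i (x/t)^n, in which t disappears exactly
    when i = n. *)
Lemma coef0_xt_product (F : fieldType) (a b : nat -> F) n :
  (lconst (ps_laurent a) * xt_subst (-1) (ps_laurent b)) n 0
  = ps_laurent (hadamard a b) n.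
Proof.
rewrite lconst_monom coef_monomM subr0 xt_substE mulrC coef_monomM.
rewrite mulN1r opprK add0r !coef_ps_laurent; case: n => [k|k]; last by rewrite mul0r.
by rewrite mulrC.
Qed.

Theorem theorem15 (F : fieldType) (a b : nat -> F) (A B : ratfun F)
    (hA : proper_rational a A) (hB : proper_rational b B) :
  exists U V : ratfun (ratfun F),
    [/\ partial_fractions (in_t A * in_x_over_t B) U V,
        nonneg_powers_t (xt_series U),
        neg_powers_t (xt_series V)
      & exists U0 : ratfun F,
          is_value (fun c : ratfun F => c) 0 U U0 /\
          ratfun_series U0 = ps_laurent (hadamard a b)].
Proof.
have [P [Q [-> sPQ Q0 aQ]]] := proper_rational_reduced hA.
have [R [S [-> sRS S0 bS]]] := proper_rational_reduced hB.
have nz (p : {poly F}) : p`_0 != 0 -> p != 0.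
  by apply: contraNneq => ->; rewrite coef0.
(* [s] is the degree of [S], not just a bound for it, so that S~ has degree [s]
   and the fraction below is proper. *)
pose s := (size S).-1.
have sS : size S = s.+1 by rewrite prednK // size_poly_gt0 nz.
have sR : (size R <= s.+1)%N by rewrite -sS ltnW.
pose Pt := map_poly (@rconst F) P; pose Qt := map_poly (@rconst F) Q.
pose Rt := homog s rX (map_poly (@rconst F) R).
pose St := homog s rX (map_poly (@rconst F) S).
have sSt : size St = s.+1 by rewrite size_homog // coef_map fmorph_eq0.
have Qt0 : Qt != 0 by rewrite map_poly_eq0 nz.
have St0 : St != 0 by rewrite -size_poly_gt0 sSt.
have co : coprimep Qt St by exact: coprimep_homog.
have sN : (size (Pt * Rt)%R < size (Qt * St)%R)%N.
  apply: size_mul_ltn; rewrite ?St0 //; first by rewrite !size_map_poly.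
  by rewrite sSt; exact: size_poly.
have [P1 [P2 [NE sP2 pf]]] := partial_fractions_coprime co sN.
have EQt : xt_poly Qt = lconst (ps_laurent (fun k => Q`_k)).
  by rewrite xt_poly_rconst ratfun_series_poly.
have ESt : xt_poly St = lconst lX ^+ s * xt_subst (-1) (ps_laurent (fun k => S`_k)).
  by rewrite xt_poly_homog ?sS // ratfun_series_poly.
have EQt0 : xt_poly Qt != 0 by rewrite EQt fmorph_eq0 ps_laurent_eq0 // nz.
have X0 : lconst lX != 0 :> laurent (laurent F) by rewrite fmorph_eq0 lX_neq0.
have ESt0 : xt_poly St != 0.
  by rewrite ESt mulf_neq0 ?expf_neq0 // fmorph_eq0 ps_laurent_eq0 // nz.
have QtV : t_supported (fun m => 0 <= m) (xt_poly Qt)^-1.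
  have [q qE] := ps_laurentV (p := fun k => Q`_k) Q0.
  rewrite EQt -fmorphV qE; apply: t_supported_lconst => m.
  by rewrite coef_ps_laurent; case: m.
have StV : t_supported (fun m => m <= - s%:Z) (xt_poly St)^-1.
  have [q qE] := ps_laurentV (p := fun k => S`_k) S0.
  rewrite ESt invfM -fmorphV qE -rmorphXn -fmorphV lX_monom monomX expr1n natz.
  rewrite monomV ?oner_neq0 // invr1.
  apply: (t_supportedM (D1 := pred1 (- s%:Z)) (D2 := fun m => m <= 0)).
  - by move=> i j /eqP->; rewrite gerDl.
  - exact: t_supported_monom.
  (* In g(x/t) with g a power series, x^n comes with t^-n and n >= 0. *)
  move=> n m; rewrite xt_substE monomE coef_ps_laurent => m0.
  by case: eqP => // mn; case: n mn => // k; move: m0; clear; lia.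
have Vneg : t_supported (fun m => m < 0) (xt_poly P2 / xt_poly St).
  apply: t_supportedM (@t_supported_xt_poly _ P2) StV => i j /andP[_].
  by move: sP2; rewrite sSt; move: (size P2) => k; clear; lia.
exists (P1%:F / Qt%:F), (P2%:F / St%:F); split.
- have -> : in_t (P%:F / Q%:F) = Pt%:F / Qt%:F := in_tE P (nz Q Q0).
  have -> : in_x_over_t (R%:F / S%:F) = Rt%:F / St%:F.
    by apply: in_x_over_tE; rewrite ?sS.
  by rewrite mulf_frac.
- rewrite xt_series_frac // => n m m0.
  have D (i j : int) : (0 <= i) && (i < (size P1)%:Z) -> 0 <= j -> 0 <= i + j.
    by move=> /andP[i0 _]; exact: addr_ge0.
  by apply: (t_supportedM D (@t_supported_xt_poly _ P1) QtV); rewrite -ltNge.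
- by rewrite xt_series_frac // => n m m0; rewrite Vneg // -leNgt.
have Qt00 : Qt.[0] != 0 by rewrite horner_coef0 coef_map fmorph_eq0.
exists (P1.[0] / Qt.[0]); split.
  by exists P1, Qt; rewrite !map_poly_id.
(* Compare the coefficients of x^n t^0 in U + V = A(t) B(x/t). *)
apply: laurentP => n; rewrite -coef0_xt_product.
have -> : lconst (ps_laurent a) * xt_subst (-1) (ps_laurent b)
    = xt_poly P1 / xt_poly Qt + xt_poly P2 / xt_poly St.
  apply: mulf_partial => //.
  have <- : xt_poly Pt = lconst (ps_laurent a) * xt_poly Qt.
    by rewrite !xt_poly_rconst -aQ rmorphM.
  have <- : xt_poly Rt = xt_subst (-1) (ps_laurent b) * xt_poly St.
    by rewrite !xt_poly_homog ?sS // -bS rmorphM mulrCA.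
  by rewrite -!rmorphM -rmorphD NE.
have := @t_supported_const_term _ P1 _ Qt00 EQt0 QtV n 0 isT.
set u := _ / _; set v := _ / xt_poly St; set w := x_series _ => uw.
have {}uw : u n 0 - w n 0 = 0 := uw.
change (ratfun_series (P1.[0] / Qt.[0]) n = u n 0 + v n 0).
rewrite (Vneg n 0 isT) addr0 -[u n 0](subrK (w n 0)) uw add0r /w.
by rewrite x_seriesE xt_substE monomE mul0r eqxx.
Qed.
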